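(* Let $K\ge 1$ be a fixed integer, let $\Pi$ be an instance of a linear $K$-parametric minimization problem satisfying Assumptions (a)–(d) listed in the context, with non-parametric algorithm $\mathrm{ALG}_\alpha$ of guarantee $\alpha\ge 1$, and let $0<\varepsilon<1$. Then the grid algorithm described in the context returns a $((1+\varepsilon)\cdot\alpha)$-approximation set $S$ for $\Pi$ in time $$\mathcal{O}\left(T_{\mathrm{LB}/\mathrm{UB}}+T_{\mathrm{ALG}_\alpha}\cdot\left(\frac1\varepsilon\log\frac1\varepsilon+\frac1\varepsilon\log\frac{\mathrm{UB}}{\mathrm{LB}}+\frac1\varepsilon\log\alpha\right)^K\right),$$ where $T_{\mathrm{LB}/\mathrm{UB}}$ denotes the time needed for computing the bounds $\mathrm{LB}$ and $\mathrm{UB}$, and $T_{\mathrm{ALG}_\alpha}$ denotes the running time of $\mathrm{ALG}_\alpha$.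
   Context: Problem. An instance $\Pi$ of a linear $K$-parametric (minimization) problem is given by a nonempty (finite or infinite) set $X$ of feasible solutions, functions $a,b_1,\dots,b_K:X\to\mathbb{R}$ and a parameter set $\Lambda\subseteq\mathbb{R}^K$. For $x\in X$, $\lambda\in\Lambda$ put $f(x,\lambda)=a(x)+\sum_{k=1}^K\lambda_k b_k(x)$. For fixed $\lambda\in\Lambda$, the non-parametric problem $\Pi(\lambda)$ is $\inf_{x\in X}f(x,\lambda)$. Assumptions. (a) $\Lambda=\prod_{k=1}^K[\lambda^{\min}_k,\infty)$ for a given $\lambda^{\min}\in\mathbb{R}^K$. (b) Every $x\in X$ has encoding length polynomial in the instance size, and $a(x),b_k(x)$ can be computed in time polynomial in the instance size and the encoding length of $x$. (c) Positive rationals $\mathrm{LB}\le\mathrm{UB}$ with $b_k(x),f(x,\lambda^{\min})\in\{0\}\cup[\mathrm{LB},\mathrm{UB}]$ for all $x\in X$, $k=1,\dots,K$, can be computed in time polynomial in the instance size. (d) For some $\alpha\ge1$ (independent of $\lambda$) there is an algorithm $\mathrm{ALG}_\alpha$ that returns, for any $\lambda\in\Lambda$, a solution $x'\in X$ with $f(x',\lambda)\le\alpha\cdot f(x,\lambda)$ for all $x\in X$. Approximation. For $\beta\ge1$, $x\in X$ is a $\beta$-approximation for $\lambda\in\Lambda$ if $f(x,\lambda)\le\beta f(x',\lambda)$ for all $x'\in X$. A finite set $S\subseteq X$ is a $\beta$-approximation set for $\Pi$ if for every $\lambda\in\Lambda$ it contains a $\beta$-approximation for $\lambda$ (under the assumptions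 above, $\inf_{x}f(x,\lambda)\ge0$ for all $\lambda\in\Lambda$). Grid algorithm. Compute $\mathrm{LB},\mathrm{UB}$; set $\varepsilon'=\varepsilon/2$, $\beta=(1+\varepsilon')\alpha$, $c=\frac{\varepsilon'\cdot\mathrm{LB}}{\beta\cdot\mathrm{UB}}$, $\mathrm{lb}=\left\lfloor\log_{1+\varepsilon/2}\frac{c^K}{(K+1)!}\right\rfloor$, $\mathrm{ub}=\left\lceil\log_{1+\varepsilon/2}\frac{(K+1)!}{c^K}\right\rceil$, and let $$\Lambda^{\mathrm{Grid}}=\left\{\left(\lambda^{\min}_1+(1+\tfrac\varepsilon2)^{i_1},\dots,\lambda^{\min}_K+(1+\tfrac\varepsilon2)^{i_K}\right)^\top: i_k\in\mathbb{Z},\ \mathrm{lb}\le i_k\le\mathrm{ub},\ k=1,\dots,K\right\}.$$ Starting with $S=\emptyset$, for each $\lambda\in\Lambda^{\mathrm{Grid}}$ add to $S$ the solution returned by $\mathrm{ALG}_\alpha$ for $\lambda$; return $S$. Conventions. $\log$ is the base-2 logarithm. $K$ is a constant: the $\mathcal{O}$-constant may depend on $K$ but not on $\varepsilon,\alpha,\mathrm{LB},\mathrm{UB}$ or the instance, and the $\mathcal{O}$-bound is understood asymptotically for small $\varepsilon$ (i.e. for all $\varepsilon\in(0,\varepsilon_0]$ with some fixed $\varepsilon_0\in(0,1)$). The running time is counted as the time to compute $\mathrm{LB},\mathrm{UB}$ plus the time spent on the calls of $\mathrm{ALG}_\alpha$. *)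

(* Defs.v *)
From mathcomp Require Import all_boot all_order all_algebra.
From mathcomp Require Import finmap.
From mathcomp Require Import all_classical all_reals all_analysis.

Set Implicit Arguments.
Unset Strict Implicit.
Unset Printing Implicit Defensive.
Import Order.TTheory GRing.Theory Num.Theory.
Local Open Scope classical_set_scope.
Local Open Scope ring_scope.

(* Running times are tracked by a cost-counting (writer) monad: a computation *)
(* is its result together with the number of steps it took. *)
Record timed (A : Type) : Type := Timed { outcome : A ; cost : nat }.

Definition tret (A : Type) (x : A) : timed A := Timed x 0.

Definition tbind (A B : Type) (t : timed A) (g : A -> timed B) : timed B :=
  let u := g (outcome t) in Timed (outcome u) (cost t + cost u).

(* The whole problem, i.e. the family of its instances, is modelled, because  *)
(* "polynomial in the instance size" has no content for one fixed instance.   *)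
Record param_problem (R : realType) (K : nat) : Type := ParamProblem {
  instance : Type ;
  isize : instance -> nat ;
  sol : instance -> Type ;
  sol_nonempty : forall I : instance, inhabited (sol I) ;
  obja : forall I : instance, sol I -> R ;
  objb : forall I : instance, 'I_K -> sol I -> R ;
  params : instance -> set 'rV[R]_K }.

Arguments isize {R K p} I.
Arguments sol {R K p} I.
Arguments obja {R K p I} x.
Arguments objb {R K p I} k x.
Arguments params {R K p} I.

Section Problem.
Variables (R : realType) (K : nat) (P : param_problem R K).

Definition objf (I : instance P) (x : sol I) (lam : 'rV[R]_K) : R :=
  obja x + \sum_(k < K) lam ord0 k * objb k x.

Definition approximates (I : instance P) (beta : R) (lam : 'rV[R]_K)
    (x : sol I) : Prop :=
  forall x' : sol I, objf x lam <= beta * objf x' lam.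

Definition approximation_set (I : instance P) (beta : R) (S : set (sol I)) :
    Prop :=
  finite_set S /\
  forall lam, params I lam -> exists2 x, S x & approximates beta lam x.

(* [enclen] is the encoding length of solutions; the other fields from [evala] *)
(* on, except [alpha], are the algorithms that the assumptions provide.        *)
Record procedures : Type := Procedures {
  lmin : instance P -> 'rV[R]_K ;
  enclen : forall I : instance P, sol I -> nat ;
  evala : forall I : instance P, sol I -> timed R ;
  evalb : forall I : instance P, 'I_K -> sol I -> timed R ;
  bounds : instance P -> timed (rat * rat) ;
  alpha : instance P -> R ;
  alg : forall I : instance P, 'rV[R]_K -> timed (sol I) }.

Definition LB (A : procedures) (I : instance P) : rat :=
  (outcome (bounds A I)).1.
Definition UB (A : procedures) (I : instance P) : rat :=
  (outcome (bounds A I)).2.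

Definition zero_or_between (lo hi : rat) (y : R) : Prop :=
  y = 0 \/ ratr lo <= y <= ratr hi.

Definition assumption_a (A : procedures) : Prop :=
  forall I : instance P,
    params I = [set lam | forall k, lmin A I ord0 k <= lam ord0 k].

(* A bound polynomial in two sizes is written as a polynomial in their sum. *)
Definition assumption_b (A : procedures) : Prop :=
  [/\ exists p : {poly nat}, forall (I : instance P) (x : sol I),
        (enclen A x <= p.[isize I])%N,
      exists p : {poly nat}, forall (I : instance P) (x : sol I),
        outcome (evala A x) = obja x /\
        (cost (evala A x) <= p.[(isize I + enclen A x)%N])%N &
      exists p : {poly nat}, forall (I : instance P) (k : 'I_K) (x : sol I),
        outcome (evalb A k x) = objb k x /\
        (cost (evalb A k x) <= p.[(isize I + enclen A x)%N])%N].

Definition assumption_c (A : procedures) : Prop :=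
  (exists p : {poly nat}, forall I : instance P,
     (cost (bounds A I) <= p.[isize I])%N) /\
  (forall I : instance P,
     0 < LB A I <= UB A I /\
     forall x : sol I,
       zero_or_between (LB A I) (UB A I) (objf x (lmin A I)) /\
       forall k : 'I_K, zero_or_between (LB A I) (UB A I) (objb k x)).

Definition assumption_d (A : procedures) : Prop :=
  forall I : instance P,
    1 <= alpha A I /\
    forall lam, params I lam ->
      approximates (alpha A I) lam (outcome (alg A I lam)).

End Problem.

Arguments lmin {R K P} p I.
Arguments enclen {R K P} p {I} x.
Arguments bounds {R K P} p I.
Arguments alpha {R K P} p I.
Arguments alg {R K P} p I lam : rename.

Section Grid.
Variables (R : realType) (K : nat).

Definition logb (base x : R) : R := ln x / ln base.

Definition log2 (x : R) : R := logb 2 x.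

Definition grid_c (lo hi : rat) (alpha eps : R) : R :=
  let eps' := eps / 2 in
  let beta := (1 + eps') * alpha in
  (eps' * ratr lo) / (beta * ratr hi).

Definition grid_lb (lo hi : rat) (alpha eps : R) : int :=
  Num.floor (logb (1 + eps / 2)
    (grid_c lo hi alpha eps ^+ K / (K.+1)`!%:R)).

Definition grid_ub (lo hi : rat) (alpha eps : R) : int :=
  Num.ceil (logb (1 + eps / 2)
    ((K.+1)`!%:R / grid_c lo hi alpha eps ^+ K)).

Definition grid (lmin : 'rV[R]_K) (lo hi : rat) (alpha eps : R) :
    set 'rV[R]_K :=
  [set lam | exists2 i : 'I_K -> int,
     (forall k, grid_lb lo hi alpha eps <= i k <= grid_ub lo hi alpha eps) &
     lam = \row_k (lmin ord0 k + (1 + eps / 2) ^ i k)].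

(* The grid is a finite set, so [fset_set] does not take its default value;   *)
(* it lists each grid point exactly once, in an unspecified order.            *)
Definition grid_algorithm (X : Type) (lmin : 'rV[R]_K) (alpha : R)
    (bounds : timed (rat * rat)) (alg : 'rV[R]_K -> timed X) (eps : R) :
    timed (set X) :=
  tbind bounds (fun LU =>
    foldl (fun acc lam =>
             tbind acc (fun S =>
               tbind (alg lam) (fun x => tret (S `|` [set x]))))
          (tret set0)
          (enum_fset (fset_set (grid lmin LU.1 LU.2 alpha eps)))).

End Grid.

(* Main.v *)
Require Import Defs.
From mathcomp Require Import all_boot all_order all_algebra.
From mathcomp Require Import finmap.
From mathcomp Require Import all_classical all_reals all_analysis.
From mathcomp Require Import zify ring lra.

Set Implicit Arguments.
Unset Strict Implicit.
Unset Printing Implicit Defensive.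
Import Order.TTheory GRing.Theory Num.Theory.
Local Open Scope classical_set_scope.
Local Open Scope ring_scope.

(** Shift the parameters to mu = lam - lmin >= 0, so that f(x, lam) is the
    pairing of the weight w = (1, mu) with the vector
    (f(x, lmin), b_1(x), ..., b_K(x)), all of whose entries lie in
    {0} u [LB, UB].  A weight whose entries have ratios at most (K+1)!/c^K is
    handled by rounding it down to a grid point, which costs a factor 1 + eps/2.
    Any other weight w is replaced by a weight v with w = rho v that has such
    ratios, where the components with small rho
    are negligible: for every i the sum of the v_j with rho_j < rho_i is at
    most c v_i.  Let i maximize rho_i among the indices where a competitor z
    does not vanish.  A beta-approximation y for v must vanish wherever
    rho_j > rho_i, as a single entry LB there would cost more than beta times
    the value of z; on the other indices w <= rho_i v, and replacing v by w
    in the value of z loses only a factor 1 + c UB/LB.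

    The weight v is built by adding the components of w in increasing order:
    whenever the components already treated sum to less than c times the next
    one, all of them are scaled up by a common factor until equality holds. *)

(** * Rescaled weights: transfer of approximations, then construction *)

Lemma approx_of_rescaled (R : realFieldType) (T : finType)
    (w v rho y z : T -> R) (lo hi c b : R) :
  0 < lo -> 0 <= c -> 0 <= b -> b * c * hi < lo ->
  (forall i, 0 < v i) -> (forall i, 0 <= rho i) ->
  (forall i, w i = rho i * v i) ->
  (forall i, \sum_(j | rho j < rho i) v j <= c * v i) ->
  (forall i, y i = 0 \/ lo <= y i <= hi) ->
  (forall i, z i = 0 \/ lo <= z i <= hi) ->
  \sum_i v i * y i <= b * \sum_i v i * z i ->
  \sum_i w i * y i <= b * (1 + c * hi / lo) * \sum_i w i * z i.
Proof.
move=> lo0 c0 b0 bch v0 r0 wE low yP zP appr.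
have y0 i : 0 <= y i by case: (yP i) => [->//|/andP[+ _]]; apply: le_trans (ltW lo0).
have z0 i : 0 <= z i by case: (zP i) => [->//|/andP[+ _]]; apply: le_trans (ltW lo0).
have vy0 i : 0 <= v i * y i by rewrite mulr_ge0 // ltW.
have vz0 i : 0 <= v i * z i by rewrite mulr_ge0 // ltW.
have [/existsP[i0 zi0]|] := boolP [exists i, z i != 0]; last first.
  rewrite negb_exists => /forallP z_eq0.
  have zE i : z i = 0 by apply/eqP; rewrite -[_ == _]negbK z_eq0.
  have sumz (u : T -> R) : \sum_i u i * z i = 0 by rewrite big1 // => i _; rewrite zE mulr0.
  move: appr; rewrite !sumz !mulr0 => appr.
  rewrite big1 // => i _; have : v i * y i <= 0.
    apply: le_trans appr; rewrite (bigD1 i) //= lerDl sumr_ge0 // => j _; exact: vy0.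
  rewrite pmulr_rle0 // => yi0; have -> : y i = 0 by apply/eqP; rewrite eq_le yi0 y0.
  by rewrite mulr0.
case: (@arg_maxP _ _ _ i0 (fun i => z i != 0) rho zi0) => i zi imax.
have zhi j : z j <= hi.
  have zi_lo : lo <= hi.
    by case: (zP i) => [/eqP|/andP[]]; [rewrite (negPf zi)|apply: le_trans].
  by case: (zP j) => [->|/andP[]//]; apply: le_trans zi_lo; exact: ltW.
have hi0 : 0 <= hi by apply: le_trans (zhi i).
have lozi : lo <= z i by case: (zP i) => [/eqP|/andP[]//]; rewrite (negPf zi).
have z_above j : rho i < rho j -> z j = 0.
  by move=> ij; apply/eqP; apply: contraTT ij => /imax; rewrite -leNgt.
have y_above j : rho i < rho j -> y j = 0.
  move=> ij; case: (yP j) => // /andP[loyj _]; exfalso.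
  (* Only indices with [rho l <= rho i < rho j] contribute to the value of [z], so [low] at [j]
     bounds it; since [b * c * hi < lo], the single term [v j * y j] is then too large for
     [appr]. *)
  have : \sum_l v l * z l <= c * v j * hi.
    apply: (@le_trans _ _ (\sum_(l | rho l < rho j) v l * hi)); last first.
      by rewrite -mulr_suml ler_wpM2r.
    rewrite [leLHS](bigID (fun l => rho l < rho j)) /= [X in _ + X]big1 ?addr0.
      by apply: ler_sum => l _; rewrite ler_pM2l.
    move=> l; rewrite -leNgt => jl; rewrite z_above ?mulr0 //; exact: lt_le_trans jl.
  move=> /(ler_wpM2l b0) /(le_trans appr).
  rewrite (bigD1 j) //=; set rest := \sum_(_ | _) _ => h.
  have rest0 : 0 <= rest by rewrite sumr_ge0.
  have : v j * lo <= v j * y j by rewrite ler_pM2l.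
  have : b * c * hi * v j < lo * v j by rewrite ltr_pM2r.
  lra.
have wy : \sum_j w j * y j <= rho i * \sum_j v j * y j.
  rewrite mulr_sumr; apply: ler_sum => j _; rewrite wE -mulrA.
  have [ij|ji] := ltP (rho i) (rho j); first by rewrite y_above // !mulr0.
  by rewrite ler_wpM2r.
(* Where [rho j >= rho i], either equality holds or [z j = 0]. The other indices contribute at most
   [rho i * (c * v i * hi)], which by [lo <= z i] is at most [c * hi / lo] times the term
   [w i * z i]. *)
have wz : rho i * \sum_j v j * z j <= (1 + c * hi / lo) * \sum_j w j * z j.
  have w0 j : 0 <= w j * z j by rewrite wE -mulrA mulr_ge0.
  rewrite mulrDl mul1r (bigID (fun j => rho j < rho i)) /= addrC mulrDr.
  apply: lerD.
    rewrite mulr_sumr big_mkcond /=; apply: ler_sum => j _; case: ifP => // .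
    rewrite -leNgt => ij; rewrite wE -mulrA.
    move: ij; rewrite le_eqVlt => /orP[/eqP->//|ij].
    by rewrite z_above // !mulr0.
  have h1 : \sum_(j | rho j < rho i) v j * z j <= c * v i * hi.
    apply: le_trans (_ : \sum_(j | rho j < rho i) v j * hi <= _).
      by apply: ler_sum => j _; rewrite ler_pM2l.
    by rewrite -mulr_suml ler_wpM2r.
  apply: le_trans (ler_wpM2l (r0 i) h1) _.
  have h2 : w i * z i <= \sum_j w j * z j.
    by rewrite (bigD1 i) //= lerDl sumr_ge0.
  apply: le_trans (ler_wpM2l _ h2); last by rewrite !mulr_ge0 // invr_ge0 ltW.
  rewrite wE (_ : rho i * (c * v i * hi) = c * hi / lo * (rho i * v i * lo)).
    by rewrite ler_wpM2l ?ler_wpM2l // ?mulr_ge0 ?invr_ge0 // ltW.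
  by field; rewrite gt_eqF.
apply: le_trans wy _; apply: le_trans (ler_wpM2l (r0 i) appr) _.
by rewrite mulrCA -mulrA ler_wpM2l.
Qed.

(** The last alternative normalizes rho to be 1 at the top component, which is
    impossible only when w vanishes on A. *)
Lemma exists_rescaling (R : realFieldType) (T : finType) (w : T -> R) (c : R)
    (n : nat) (A : {set T}) :
  0 < c <= 1 -> (forall i, 0 <= w i) -> #|A| = n.+1 ->
  exists v rho : T -> R, exists2 m, m \in A &
    (forall i, i \in A -> [/\ 0 < v i, 0 <= rho i, w i = rho i * v i,
       \sum_(j in A | rho j < rho i) v j <= c * v i &
       v i <= v m /\ c ^+ n * v m <= n`!%:R * v i]) /\
    ((forall i, i \in A -> rho i = 0) \/
      rho m = 1 /\ forall i, i \in A -> rho i <= 1).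
Proof.
move=> /andP[c0 c1] w0; elim: n A => [|n IH] A.
  move=> /eqP/cards1P[m ->].
  (* A zero weight is represented by [rho = 0] and [v = 1], because [v] must stay positive. *)
  exists (fun=> if w m == 0 then 1 else w m), (fun=> (w m != 0)%:R), m; first exact: set11.
  split.
    move=> i /set1P ->; case: eqVneq (w0 m) => [->|wm0 wm] /=.
      rewrite mul0r big1 ?mulr1 ?fact0; last by move=> j; rewrite ltxx andbF.
      by split=> //; exact: ltW.
    rewrite mul1r big1; last by move=> j; rewrite ltxx andbF.
    by split; rewrite ?fact0 ?mul1r // ?mulr_ge0 ?lt0r ?wm0 // ltW.
  by case: eqVneq; [left|right].
move=> cardA.
have [m0 m0A] : exists i, i \in A by apply/set0Pn; rewrite -card_gt0 cardA.
case: (@arg_maxP _ _ _ m0 (mem A) w m0A) => m mA wmax.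
have {}mA : m \in A := mA.
have [wm|wm] := eqVneq (w m) 0.
  exists (fun=> 1), (fun=> 0), m => //; split; last by left.
  move=> i iA; split=> //.
  - by rewrite mul0r; apply/eqP; rewrite eq_le w0 andbT -wm; exact: wmax.
  - by rewrite big1 ?mulr1 ?ltW // => j; rewrite ltxx andbF.
  split=> //; rewrite !mulr1; apply: (@le_trans _ _ 1).
    by rewrite exprn_ile1 // ltW.
  by rewrite ler1n fact_gt0.
have wm0 : 0 < w m by rewrite lt0r wm w0.
have cardA' : #|A :\ m| = n.+1 by move: cardA; rewrite (cardsD1 m) mA => -[].
have [v [rho [p pA' [ok top]]]] := IH _ cardA'.
set A' := A :\ m in cardA' pA' ok top.
have v0 i : i \in A' -> 0 < v i by case/ok.
pose s := \sum_(i in A') v i.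
have s0 : 0 < s.
  rewrite /s (bigD1 p) //= ltr_wpDr ?v0 // sumr_ge0 // => i /andP[iA' _].
  by rewrite ltW ?v0.
have sp : s <= n.+1%:R * v p.
  rewrite mulr_natl -cardA' -sumr_const; apply: ler_sum => i iA'.
  by case: (ok i iA') => _ _ _ _ [].
have vs i : i \in A' -> v i <= s.
  move=> iA'; rewrite /s (bigD1 i) //= lerDl sumr_ge0 // => j /andP[jA' _].
  by rewrite ltW ?v0.
(* [t] is the common factor for the old components: [ts] controls the ratios to the new top [m],
   [rt] keeps the new [rho] at most 1, and [low] is the smallness condition at [m]. *)
have [t [t0 ts rt low tv]] : exists t, [/\ 0 < t, c * w m <= t * s,
    forall i, i \in A' -> rho i <= t,
    \sum_(i in A' | rho i < t) t * v i <= c * w m &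
    forall i, i \in A' -> t * v i <= w m].
  have scale : (forall i, i \in A' -> rho i <= c * w m / s) -> exists t,
      [/\ 0 < t, c * w m <= t * s, forall i, i \in A' -> rho i <= t,
      \sum_(i in A' | rho i < t) t * v i <= c * w m &
      forall i, i \in A' -> t * v i <= w m].
    move=> rt; have t0 : 0 < c * w m / s by rewrite divr_gt0 ?mulr_gt0.
    exists (c * w m / s); have tsE : c * w m / s * s = c * w m by rewrite divfK ?gt_eqF.
    split=> //; first by rewrite tsE.
      rewrite -[leRHS]tsE /s mulr_sumr big_mkcondr /=; apply: ler_sum => i iA'.
      by case: ifP => // _; rewrite ltW // mulr_gt0 ?v0.
    move=> i iA'; apply: (@le_trans _ _ (c * w m / s * s)).
      by rewrite ler_pM2l ?vs.
    by rewrite tsE ger_pMl.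
  case: top => [rho0|[rp1 rho1]].
    by apply: scale => i /rho0 ->; rewrite ltW // divr_gt0 ?mulr_gt0.
  (* If [s < c * w m], the factor [c * w m / s] exceeds 1 and hence every [rho i]. Otherwise [t = 1]
     works: as [rho p = 1], smallness at [p] passes to [m] through [v p = w p <= w m]. *)
  have [big|small] := lerP (c * w m) s; last first.
    apply: scale => i /rho1 h; apply: le_trans h _.
    by rewrite ler_pdivlMr // mul1r ltW.
  have [_ _ wp lowp _] := ok p pA'.
  have vpw : v p <= w m.
    by move: wp; rewrite rp1 mul1r => <-; apply: wmax; case/setD1P: pA'.
  exists 1; split=> //; first by rewrite mul1r.
    under eq_bigr do rewrite mul1r.
    by move: lowp; rewrite rp1 => /le_trans; apply; rewrite ler_pM2l.
  move=> i iA'; rewrite mul1r; apply: le_trans vpw.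
  by case: (ok i iA') => _ _ _ _ [].
pose v' i := if i == m then w m else t * v i.
pose rho' i := if i == m then 1 else rho i / t.
have v'm : v' m = w m by rewrite /v' eqxx.
have rho'm : rho' m = 1 by rewrite /rho' eqxx.
have v'E i : i \in A' -> v' i = t * v i by rewrite /v' => /setD1P[/negPf ->].
have rho'E i : i \in A' -> rho' i = rho i / t by rewrite /rho' => /setD1P[/negPf ->].
have rho'1 i : i \in A -> rho' i <= 1.
  move=> iA; have [->|im] := eqVneq i m; first by rewrite rho'm.
  have iA' : i \in A' by apply/setD1P.
  by rewrite rho'E // ler_pdivrMr // mul1r rt.
(* Since [rho' m = 1], the index [m] never enters a sum over [rho' j < a <= 1]. *)
have split_sum a : a <= 1 ->
    \sum_(j in A | rho' j < a) v' j = \sum_(j in A' | rho j < t * a) t * v j.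
  move=> a1; rewrite big_mkcondr (big_setD1 m) //= rho'm ltNge a1 add0r.
  rewrite [RHS]big_mkcondr /=; apply: eq_bigr => j jA'.
  by rewrite rho'E // v'E // ltr_pdivrMr // mulrC.
exists v', rho', m => //; split; last by right; split.
move=> i iA; have [->|im] := eqVneq i m.
  rewrite v'm rho'm split_sum // mulr1 mul1r; split=> //; split=> //.
  rewrite ler_pM2r //; apply: (@le_trans _ _ 1).
    by rewrite exprn_ile1 // ltW.
  by rewrite ler1n fact_gt0.
have iA' : i \in A' by apply/setD1P.
have [vi0 ri0 wi lowi [vip vpi]] := ok i iA'.
have ri1 := rho'1 i iA.
rewrite split_sum // v'E // rho'E // v'm; split.
- by rewrite mulr_gt0.
- by rewrite divr_ge0 // ltW.
- by rewrite wi; field; rewrite gt_eqF.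
- rewrite -mulr_sumr [t * (_ / _)]mulrC divfK ?gt_eqF //.
  by rewrite mulrCA ler_pM2l.
split; first exact: tv.
(* The factorial grows here: [c * w m <= t * s] and [s <= n.+1 * v p] contribute the factor [n.+1],
   and induction compares [v p] with [v i]. *)
rewrite exprS mulrAC.
apply: (@le_trans _ _ (t * (n.+1%:R * v p) * c ^+ n)).
  rewrite ler_pM2r ?exprn_gt0 //; apply: le_trans ts _.
  by rewrite ler_pM2l.
rewrite factS natrM (_ : t * _ * _ = n.+1%:R * (t * (c ^+ n * v p))); last by ring.
by rewrite -mulrA ler_pM2l ?ltr0n // [_ * (t * _)]mulrCA ler_pM2l.
Qed.

(** Dividing [v] by [v ord0] and multiplying [rho] by it changes neither [w] nor the order of the
    [rho i]. With first entry 1, [v] is the weight of an actual parameter. *)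
Lemma exists_normalized_rescaling (R : realFieldType) (K : nat)
    (w : 'I_K.+1 -> R) (c : R) :
  0 < c <= 1 -> (forall i, 0 <= w i) ->
  exists v rho : 'I_K.+1 -> R, v ord0 = 1 /\
    forall i, [/\ 0 < v i, 0 <= rho i, w i = rho i * v i,
      \sum_(j | rho j < rho i) v j <= c * v i &
      c ^+ K / K`!%:R <= v i <= K`!%:R / c ^+ K].
Proof.
move=> c01 w0; have /andP[c0 c1] := c01.
have [|v [rho [m _ [ok _]]]] := @exists_rescaling R _ w c K [set: 'I_K.+1] c01 w0.
  by rewrite cardsT card_ord.
have v0 i : 0 < v i by case: (ok i (finset.in_setT i)).
have f0 : (0 : R) < K`!%:R by rewrite ltr0n fact_gt0.
have cK0 : 0 < c ^+ K by rewrite exprn_gt0.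
exists (fun i => v i / v ord0), (fun i => rho i * v ord0); rewrite divff ?gt_eqF //.
split=> // i; have [_ ri wi lowi [vim vmi]] := ok i (finset.in_setT i).
have [_ _ _ _ [v0m vm0]] := ok ord0 (finset.in_setT ord0).
split.
- by rewrite divr_gt0.
- by rewrite mulr_ge0 // ltW.
- by rewrite wi; field; rewrite gt_eqF.
- rewrite -mulr_suml mulrA ler_pM2r ?invr_gt0 //.
  apply: le_trans lowi; rewrite le_eqVlt; apply/orP; left; apply/eqP.
  by apply: eq_bigl => j; rewrite inE /= ltr_pM2r.
rewrite ler_pdivlMr // ler_pdivrMr //; apply/andP; split.
  rewrite mulrAC ler_pdivrMr // [leRHS]mulrC; apply: le_trans vmi.
  by rewrite ler_pM2l.
rewrite mulrAC ler_pdivlMr // mulrC; apply: le_trans vm0.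
by rewrite ler_pM2l.
Qed.

(** * Size of the grid and effect of the loop over it *)

(** Each grid point is given by a vector of [K] offsets from [grid_lb]; the strict bound on the
    difference leaves room for both end points. *)
Lemma grid_card (R : realType) (K : nat) (lmin : 'rV[R]_K) (lo hi : rat)
    (alpha eps : R) (n : nat) :
  grid_ub K lo hi alpha eps - grid_lb K lo hi alpha eps < n%:Z ->
  finite_set (grid lmin lo hi alpha eps) /\
  (size (enum_fset (fset_set (grid lmin lo hi alpha eps))) <= n ^ K)%N.
Proof.
move=> ltn.
pose point (h : {ffun 'I_K -> 'I_n}) : 'rV[R]_K :=
  \row_k (lmin ord0 k + (1 + eps / 2) ^ (grid_lb K lo hi alpha eps + h k)).
have sub : grid lmin lo hi alpha eps `<=` [set` map point (enum {ffun 'I_K -> 'I_n})].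
  move=> _ [i ib ->] /=.
  have ih k : (absz (i k - grid_lb K lo hi alpha eps) < n)%N.
    by have := ib k; lia.
  apply/mapP; exists [ffun k => Ordinal (ih k)]; first by rewrite mem_enum.
  apply/rowP => k; rewrite !mxE ffunE /=; congr (_ + _ ^ _).
  by have := ib k; lia.
have fin : finite_set (grid lmin lo hi alpha eps).
  by apply: sub_finite_set sub _; exact: finite_seq.
split=> //; have -> : (n ^ K)%N = size (map point (enum {ffun 'I_K -> 'I_n})).
  by rewrite size_map -cardE card_ffun !card_ord.
apply: uniq_leq_size => [|lam]; first exact: fset_uniq.
by move=> lamg; apply: sub; move: lamg; rewrite [_ \in _]in_fset_set // inE.
Qed.

Lemma outcome_foldl_collect (V : eqType) (X : Type) (alg : V -> timed X) (s : seq V)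
    (acc : timed (set X)) :
  outcome (foldl (fun acc v => tbind acc (fun S =>
    tbind (alg v) (fun x => tret (S `|` [set x])))) acc s) =
  outcome acc `|` [set x | exists2 v, v \in s & x = outcome (alg v)].
Proof.
elim: s acc => [|v s IH] acc /=.
  by rewrite [X in _ `|` X](_ : _ = set0) ?setU0 //; apply/seteqP; split=> x // -[].
rewrite IH /= -setUA; congr (_ `|` _); apply/seteqP; split=> x /=.
  by move=> [->|[u us ->]]; [exists v|exists u]; rewrite // inE ?eqxx ?us ?orbT.
by move=> [u]; rewrite inE => /orP[/eqP -> ->|us ->]; [left|right; exists u].
Qed.

Lemma cost_foldl_collect (V : eqType) (X : Type) (alg : V -> timed X) (s : seq V)
    (acc : timed (set X)) :
  cost (foldl (fun acc v => tbind acc (fun S =>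
    tbind (alg v) (fun x => tret (S `|` [set x])))) acc s) =
  (cost acc + \sum_(v <- s) cost (alg v))%N.
Proof.
elim: s acc => [|v s IH] acc /=; first by rewrite big_nil addn0.
by rewrite IH big_cons /= addn0 addnA.
Qed.

(** * Logarithm estimates and rounding to powers *)

(** The bound [ln (1 + u) <= u] at [u = - (x / (1 + x))], where [1 + u = (1 + x)^-1], yields
    [x / (1 + x) <= ln (1 + x)]. *)
Lemma ln1D_ge_half (R : realType) (x : R) : 0 <= x <= 1 -> x / 2 <= ln (1 + x).
Proof.
move=> /andP[x0 x1].
have h : - 1 < - (x / (1 + x)) by rewrite ltrN2 ltr_pdivrMr; lra.
have := le_ln1Dx h.
have -> : 1 + - (x / (1 + x)) = (1 + x)^-1 by field; lra.
rewrite lnV ?posrE; last lra.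
have : x / 2 <= x / (1 + x) by rewrite ler_wpM2l // lef_pV2 ?posrE; lra.
lra.
Qed.

Lemma floor_logb (R : realType) (q r : R) : 1 < q -> 0 < r ->
  q ^ Num.floor (logb q r) <= r <= q * q ^ Num.floor (logb q r).
Proof.
move=> q1 r0; have q0 : 0 < q by apply: lt_trans q1.
have lnq : 0 < ln q by rewrite ln_gt0.
have rE : r = q `^ (logb q r).
  apply: ln_inj; rewrite ?posrE ?powR_gt0 // ln_powR /logb divfK //.
  by rewrite gt_eqF.
have /andP[h1 h2] := floor_itv (logb q r).
have -> : q * q ^ Num.floor (logb q r) = q ^ (Num.floor (logb q r) + 1).
  by rewrite expfzDr ?gt_eqF // mulrC.
have powz (z : int) : q ^ z = q `^ z%:~R by rewrite powR_intmul // ltW.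
rewrite !powz [X in _ <= X <= _]rE !ler_powR ?h1 ?ltW //.
Qed.

(** * A grid point serving a given parameter *)

(** Index [ord0] carries [objf x lmin] rather than [obja x], so that assumption (c) applies to every
    entry. *)
Definition homogeneous_objective (R : realType) (K : nat) (P : param_problem R K)
    (I : instance P) (lmin : 'rV[R]_K) (x : sol I) (i : 'I_K.+1) : R :=
  if unlift ord0 i is Some k then objb k x else objf x lmin.

Definition homogeneous_weight (R : realType) (K : nat) (lmin lam : 'rV[R]_K)
    (i : 'I_K.+1) : R :=
  if unlift ord0 i is Some k then lam ord0 k - lmin ord0 k else 1.

Lemma objf_homogeneous (R : realType) (K : nat) (P : param_problem R K)
    (I : instance P) (lmin lam : 'rV[R]_K) (x : sol I) :
  objf x lam =
  \sum_i homogeneous_weight lmin lam i * homogeneous_objective lmin x i.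
Proof.
rewrite big_ord_recl /homogeneous_weight /homogeneous_objective unlift_none mul1r.
under eq_bigr do rewrite liftK mulrBl.
by rewrite sumrB /objf; ring.
Qed.

Lemma grid_c_itv (R : realType) (lo hi : rat) (al eps : R) :
  0 < lo <= hi -> 1 <= al -> 0 < eps < 1 -> 0 < grid_c lo hi al eps <= 1.
Proof.
move=> /andP[]; rewrite -(ltr0q R) -(ler_rat R) /grid_c.
move: (ratr lo) (ratr hi) => a b a0 ab al1 /andP[e0 e1].
have al0 : 0 < al by apply: lt_le_trans al1.
have b0 : 0 < b by apply: lt_le_trans ab.
have q1 : 1 < 1 + eps / 2 by lra.
have h : 1 <= (1 + eps / 2) * al by rewrite mulr_ege1 // ltW.
have hb : 0 < (1 + eps / 2) * al * b by rewrite mulr_gt0 //; lra.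
apply/andP; split; first by rewrite divr_gt0 // mulr_gt0 //; lra.
rewrite ler_pdivrMr // mul1r.
by apply: (@le_trans _ _ (1 * b)); [apply: ler_pM => //; lra|rewrite ler_pM2r].
Qed.

(** The grid point rounds the rescaled weight of [lam], independently of [x] and of the competitor.
    Rounding costs the factor [1 + eps / 2], rescaling the factor [1 + c * UB / LB]. *)
Lemma grid_approximates (R : realType) (K : nat) (P : param_problem R K)
    (A : procedures P) (I : instance P) (eps : R) (lam : 'rV[R]_K) :
  assumption_a A -> assumption_c A -> 1 <= alpha A I -> 0 < eps < 1 ->
  params I lam ->
  exists2 g, grid (lmin A I) (LB A I) (UB A I) (alpha A I) eps g &
    forall x : sol I, approximates (alpha A I) g x ->
      approximates ((1 + eps) * alpha A I) lam x.
Proof.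
move=> aA [_ cA] al1 /andP[e0 e1]; rewrite aA => lam_ge.
have [/andP[LB0 LBUB] FP] := cA I.
have [lo0 lohi] : (0 : R) < ratr (LB A I) /\ (ratr (LB A I) : R) <= ratr (UB A I).
  by rewrite ltr0q ler_rat.
have hi0 : (0 : R) < ratr (UB A I) by apply: lt_le_trans lohi.
have al0 : 0 < alpha A I by apply: lt_le_trans al1.
set q := 1 + eps / 2; have q1 : 1 < q by rewrite /q; lra.
set c := grid_c (LB A I) (UB A I) (alpha A I) eps.
(* [c] is defined to make this identity hold; it yields both the strict inequality [small] and the
   final loss [eps / 2]. *)
have cE : q * alpha A I * c * ratr (UB A I) = eps / 2 * ratr (LB A I).
  by rewrite /c /grid_c -/q; field; rewrite !gt_eqF //; lra.
have c01 : 0 < c <= 1 by apply: grid_c_itv; rewrite ?LB0 ?e0.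
have /andP[c0 c1] := c01.
pose F := @homogeneous_objective R K P I (lmin A I).
have FPx x i : F x i = 0 \/ ratr (LB A I) <= F x i <= ratr (UB A I).
  have [F0 Fk] := FP x.
  by rewrite /F /homogeneous_objective; case: unliftP => [k _|_]; [exact: Fk|].
have F0 x i : 0 <= F x i.
  by case: (FPx x i) => [->//|/andP[+ _]]; apply: le_trans; exact: ltW.
have [|v [rho [v1 ok]]] := @exists_normalized_rescaling R K
    (homogeneous_weight (lmin A I) lam) c c01.
  by move=> i; rewrite /homogeneous_weight; case: unliftP => // k _; rewrite subr_ge0.
pose e k := Num.floor (logb q (v (lift ord0 k))).
have q0 : 0 < q by apply: lt_trans q1.
have v0 i : 0 < v i by case: (ok i).
have lnq : 0 < ln q by rewrite ln_gt0.
have cK0 : 0 < c ^+ K by rewrite exprn_gt0.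
have f0 n : (0 : R) < n`!%:R by rewrite ltr0n fact_gt0.
pose g : 'rV[R]_K := \row_k (lmin A I ord0 k + q ^ e k).
exists g.
  exists e => // k; rewrite /grid_lb /grid_ub -/q -/c.
  have [_ _ _ _ /andP[vlo vhi]] := ok (lift ord0 k).
  (* The entries of [v] are bounded through K!, the exponent range through (K+1)!, and the larger
     factorial gives the wider range. *)
  have factS_le : (K`!%:R : R) <= (K.+1)`!%:R by rewrite ler_nat factS leq_pmull.
  have mono r s : 0 < r -> r <= s -> logb q r <= logb q s.
    move=> r0 rs; rewrite /logb ler_pM2r ?invr_gt0 //.
    by rewrite ler_ln ?posrE // (lt_le_trans r0).
  apply/andP; split.
    apply: le_floor; apply: mono; first by rewrite divr_gt0.
    by apply: le_trans vlo; rewrite ler_pM2l // lef_pV2 ?posrE.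
  rewrite -(ler_int R); apply: (le_trans (floor_le _)).
  apply: (le_trans _ (ceil_ge _)); apply: mono => //.
  by apply: le_trans vhi _; rewrite ler_pM2r ?invr_gt0.
move=> x apx y.
have gw i : homogeneous_weight (lmin A I) g i <= v i
            <= q * homogeneous_weight (lmin A I) g i.
  rewrite /homogeneous_weight; case: unliftP => [k ->|->].
    by rewrite mxE addrC addKr; apply: floor_logb.
  by rewrite v1 mulr1 lexx ltW.
(* The factor [q] is paid only on the side of [x]; on the side of [y] the weights of [g] are at most
   [v]. *)
have vapx : \sum_i v i * F x i <= q * alpha A I * \sum_i v i * F y i.
  apply: (@le_trans _ _ (q * objf x g)).
    rewrite (objf_homogeneous (lmin A I)) mulr_sumr; apply: ler_sum => i _.
    by rewrite mulrA ler_wpM2r //; have /andP[] := gw i.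
  rewrite -mulrA ler_pM2l //; apply: le_trans (apx y) _.
  rewrite ler_pM2l // (objf_homogeneous (lmin A I)); apply: ler_sum => i _.
  by rewrite ler_wpM2r //; have /andP[] := gw i.
rewrite !(objf_homogeneous (lmin A I)).
have b0 : 0 <= q * alpha A I by rewrite mulr_ge0 // ltW.
have small : q * alpha A I * c * ratr (UB A I) < ratr (LB A I).
  by rewrite cE -[ltRHS]mul1r ltr_pM2r //; lra.
have r0 i : 0 <= rho i by case: (ok i).
have wE i : homogeneous_weight (lmin A I) lam i = rho i * v i by case: (ok i).
have low i : \sum_(j | rho j < rho i) v j <= c * v i by case: (ok i).
apply: (le_trans (approx_of_rescaled lo0 (ltW c0) b0 small v0 r0 wE low
  (FPx x) (FPx y) vapx)).
apply: ler_wpM2r.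
  apply: sumr_ge0 => i _; rewrite mulr_ge0 //.
  by rewrite wE mulr_ge0 // ltW.
have -> : q * alpha A I * (1 + c * ratr (UB A I) / ratr (LB A I)) =
    q * alpha A I + eps / 2.
  have -> : eps / 2 = q * alpha A I * c * ratr (UB A I) / ratr (LB A I).
    by rewrite cE mulfK ?gt_eqF.
  ring.
(* As [1 <= alpha], the additive [eps / 2] is absorbed into [(1 + eps) * alpha]. *)
have : eps / 2 * 1 <= eps / 2 * alpha A I by rewrite ler_pM2l //; lra.
rewrite /q; lra.
Qed.

(** * Number of exponents per coordinate *)

(** The end points are opposite, so the count is [2 * ceil y + 1 < 2 * y + 3] with
    [y = ln M / ln q]. The bound [eps / 4 <= ln q] turns [2 * y] into [8 / eps * ln M], and
    [eps <= 1 / 2] makes [1 / eps * L] at least 1, which absorbs the 3. *)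
Lemma grid_width (R : realType) (K : nat) (lo hi : rat) (al eps : R) :
  0 < lo <= hi -> 1 <= al -> 0 < eps <= 1 / 2 ->
  (`|grid_ub K lo hi al eps - grid_lb K lo hi al eps| + 1)%N%:R <=
  (8 * ((K.+1)`!%:R + 3 * K%:R) + 3) *
  (1 / eps * log2 (1 / eps) + 1 / eps * log2 (ratr hi / ratr lo)
   + 1 / eps * log2 al).
Proof.
move=> /andP[rlo0 rlohi] al1 /andP[e0 e1].
have [lo0 lohi] : (0 : R) < ratr lo /\ (ratr lo : R) <= ratr hi.
  by rewrite ltr0q ler_rat.
have hi0 : (0 : R) < ratr hi by apply: lt_le_trans lohi.
have al0 : 0 < al by apply: lt_le_trans al1.
have ln20 : (0 : R) < ln 2 by rewrite ln_gt0 // ltr1n.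
have ln21 : ln 2 <= (1 : R).
  have h : (-1 : R) < 1 by lra.
  by have := le_ln1Dx h; rewrite (_ : 1 + 1 = 2).
have ln_log2 (x : R) : 1 <= x -> 0 <= ln x <= log2 x.
  move=> x1; rewrite ln_ge0 //= /log2 /logb ler_pdivlMr //.
  by rewrite ler_piMr ?ln_ge0.
have ie2 : 2 <= 1 / eps by rewrite ler_pdivlMr //; lra.
have hl1 : (1 : R) <= ratr hi / ratr lo by rewrite ler_pdivlMr // mul1r.
have log_e : 1 <= log2 (1 / eps).
  rewrite /log2 /logb ler_pdivlMr // [leLHS]mul1r ler_ln ?posrE //; lra.
have /andP[le0 leL] : 0 <= ln (1 / eps) <= log2 (1 / eps) by apply: ln_log2; lra.
have /andP[lh0 lhL] := ln_log2 _ hl1.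
have /andP[la0 laL] := ln_log2 _ al1.
rewrite -!mulrDr; set L := log2 _ + _ + _.
have L1 : 1 <= L by rewrite /L; lra.
set f : R := (K.+1)`!%:R.
have f1 : 1 <= f by rewrite ler1n fact_gt0.
set c := grid_c lo hi al eps.
have /andP[c0 c1] : 0 < c <= 1.
  by apply: grid_c_itv; rewrite ?rlo0 //; apply/andP; split; lra.
(* The factor [2 + eps] of [c^-1] has logarithm at most [1 + eps <= 2 * L]; the other three factors
   contribute at most [L] together. *)
have lnc : - ln c <= 3 * L.
  rewrite -lnV ?posrE //.
  have -> : c^-1 = (1 + (1 + eps)) * (1 / eps) * (ratr hi / ratr lo) * al.
    by rewrite /c /grid_c; field; rewrite !gt_eqF //; lra.
  have p1 : 0 < 1 + (1 + eps) by lra.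
  have p2 : 0 < 1 / eps by lra.
  have p3 : 0 < ratr hi / ratr lo :> R by lra.
  rewrite lnM ?posrE ?(mulr_gt0 (mulr_gt0 p1 p2) p3) //.
  rewrite lnM ?posrE ?(mulr_gt0 p1 p2) // lnM ?posrE //.
  have : ln (1 + (1 + eps)) <= 1 + eps by apply: le_ln1Dx; lra.
  rewrite /L in L1 *; lra.
set M := f / c ^+ K.
have M0 : 0 < M by rewrite divr_gt0 ?exprn_gt0 //; lra.
have lnM_le : ln M <= (f + 3 * K%:R) * L.
  rewrite /M ln_div ?posrE ?exprn_gt0 //; last lra.
  rewrite lnXn // -mulr_natl.
  have h1 : K%:R * - ln c <= K%:R * (3 * L) by rewrite ler_wpM2l.
  have h2 : ln f <= f.
    have := @le_ln1Dx R (f - 1); rewrite (_ : 1 + (f - 1) = f); last lra.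
    by move=> h; apply: le_trans (h _) _; lra.
  have h3 : f <= f * L by rewrite ler_peMr //; lra.
  lra.
have lnM0 : 0 <= ln M.
  apply: ln_ge0; rewrite ler_pdivlMr ?exprn_gt0 // mul1r.
  by apply: le_trans f1; rewrite exprn_ile1 // ltW.
set q := 1 + eps / 2.
have lnq : eps / 4 <= ln q.
  have h : 0 <= eps / 2 <= 1 by apply/andP; split; lra.
  by have := ln1D_ge_half h; rewrite -/q; lra.
have lnq0 : 0 < ln q by lra.
set y := logb q M.
have lbE : grid_lb K lo hi al eps = - Num.ceil y.
  rewrite /grid_lb -/c -/f -/q floorNceil /y /logb -mulNr -lnV ?posrE //.
    by rewrite /M invf_div.
  by rewrite divr_gt0 ?exprn_gt0 //; lra.
have ubE : grid_ub K lo hi al eps = Num.ceil y by [].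
have y0 : 0 <= y by rewrite /y /logb divr_ge0 // ltW.
have cy0 : 0 <= Num.ceil y by rewrite ceil_ge0; lra.
rewrite lbE ubE opprK natrD natr_absz ger0_norm ?addr_ge0 // intrD.
have := ceilB1_lt y; rewrite intrB => cy.
have yL : y <= 4 * ((f + 3 * K%:R) * L) * (1 / eps).
  rewrite /y /logb; apply: (@le_trans _ _ (ln M * (eps / 4)^-1)).
    by rewrite ler_wpM2l // lef_pV2 ?posrE //; lra.
  rewrite (_ : _ * (1 / eps) = ((f + 3 * K%:R) * L) * (eps / 4)^-1).
    by rewrite ler_wpM2r // invr_ge0; lra.
  by field; rewrite gt_eqF.
have : 1 * 1 <= 1 / eps * L by apply: ler_pM => //; lra.
nra.
Qed.

Theorem theorem2p14 (R : realType) (K : nat) (hK : (1 <= K)%N) :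
  exists C eps0 : R, 0 < C /\ 0 < eps0 < 1 /\
  forall (P : param_problem R K) (A : procedures P),
    assumption_a A -> assumption_b A -> assumption_c A -> assumption_d A ->
  forall (I : instance P) (eps : R), 0 < eps < 1 ->
    let run := grid_algorithm (lmin A I) (alpha A I) (bounds A I) (alg A I) eps in
    approximation_set ((1 + eps) * alpha A I) (outcome run) /\
    (eps <= eps0 ->
     forall T_ALG : nat,
       (forall lam, params I lam -> (cost (alg A I lam) <= T_ALG)%N) ->
       (cost run)%:R <=
         C * ((cost (bounds A I))%:R
              + T_ALG%:R
                * (1 / eps * log2 (1 / eps)
                   + 1 / eps * log2 (ratr (UB A I) / ratr (LB A I))
                   + 1 / eps * log2 (alpha A I)) ^+ K)).
Proof.
pose D : R := 8 * ((K.+1)`!%:R + 3 * K%:R) + 3.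
have D1 : 1 <= D.
  have : (0 : R) <= (K.+1)`!%:R + 3 * K%:R by rewrite addr_ge0 ?mulr_ge0.
  by rewrite /D; lra.
have DK1 : 1 <= D ^+ K by rewrite exprn_ege1.
(* [D] bounds the width per coordinate, hence the power [K]; being at least 1, [D ^+ K] also covers
   the time for the bounds. *)
exists (D ^+ K), (1 / 2); split; first by lra.
split; first by apply/andP; split; lra.
move=> P A aA bA cA dA I eps e01 run.
have /andP[e0 e1] := e01.
have [al1 algP] := dA I.
set G := grid (lmin A I) (LB A I) (UB A I) (alpha A I) eps.
(* The absolute value gives a usable [n] for every [eps < 1], whatever the sign of the
   difference. *)
set n := (`|grid_ub K (LB A I) (UB A I) (alpha A I) eps
          - grid_lb K (LB A I) (UB A I) (alpha A I) eps| + 1)%N.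
have [|finG sizeG] := @grid_card R K (lmin A I) (LB A I) (UB A I) (alpha A I) eps n.
  by rewrite /n; lia.
rewrite -/G in finG sizeG.
have inG g : (g \in enum_fset (fset_set G)) = (g \in G) by exact: in_fset_set.
(* Grid points exceed [lmin] by powers of [1 + eps / 2], so they are admissible calls for both the
   guarantee and the time bound of [alg]. *)
have G_params g : g \in G -> params I g.
  rewrite inE aA => -[i _ ->] k; rewrite mxE lerDl exprz_ge0 //; lra.
have runE : outcome run =
    [set x | exists2 g, g \in enum_fset (fset_set G) & x = outcome (alg A I g)].
  by rewrite /run /grid_algorithm /tbind /= outcome_foldl_collect set0U.
split.
  split.
    rewrite runE; apply: sub_finite_set (finite_image (fun g => outcome (alg A I g)) finG).
    by move=> x [g gG ->]; exists g => //; move: gG; rewrite inG inE.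
  move=> lam lamP.
  have [g gG gapx] := grid_approximates aA cA al1 e01 lamP.
  have gG' : g \in G by rewrite inE.
  exists (outcome (alg A I g)); first by rewrite runE; exists g; rewrite // inG.
  by apply: gapx; apply: algP; exact: G_params.
move=> e12 T costT.
have [LBUB _] := cA.2 I.
have eps12 : 0 < eps <= 1 / 2 by rewrite e0.
have := grid_width K LBUB al1 eps12; rewrite -/D -/n.
set Q := _ + _ + _ => nQ.
have costE : (cost run <= cost (bounds A I) + n ^ K * T)%N.
  rewrite /run /grid_algorithm /tbind /= cost_foldl_collect /= add0n leq_add2l.
  apply: (@leq_trans (size (enum_fset (fset_set G)) * T)%N); last first.
    by rewrite leq_mul2r sizeG orbT.
  have -> : (size (enum_fset (fset_set G)) * T)%N = (\sum_(g <- enum_fset (fset_set G)) T)%N.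
    by rewrite big_const_seq count_predT iter_addn_0 mulnC.
  rewrite big_seq [leqRHS]big_seq; apply: leq_sum => g; rewrite inG => gG.
  by apply: costT; exact: G_params.
apply: (@le_trans _ _ (cost (bounds A I) + n ^ K * T)%N%:R); first by rewrite ler_nat.
rewrite natrD natrM natrX mulrDr; apply: lerD; first by rewrite ler_peMl.
rewrite [leRHS]mulrCA [leRHS]mulrC ler_wpM2r // -exprMn.
by apply: lerXn2r; rewrite ?nnegrE // (le_trans _ nQ).
Qed.
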